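(* Let $G$ be a connected graph with vertex $i$. Then $(G,i)$ allows the nullity pair $(1,2)$ if and only if it is not the case that $(G,i)$ is a yam graph with $G-i$ having at most one component.
   Context: All matrices are real. For a simple graph $G$ on $[n]$, $\mathcal{S}(G)$ is the set of real symmetric $n\times n$ matrices whose off-diagonal $(j,k)$ entry is nonzero iff $\{j,k\}\in E(G)$ (diagonal free). $A(i)$ is $A$ with row and column $i$ deleted (a $0\times 0$ matrix has nullity $0$). $(G,i)$ allows the nullity pair $(k,\ell)$ if some $A\in\mathcal{S}(G)$ has $(\operatorname{null}(A),\operatorname{null}(A(i)))=(k,\ell)$. A generalized star is a tree with exactly one vertex of degree at least $3$ (its center). A yam graph is a connected rooted graph $(G,i)$ such that each component of $G-i$ is a generalized star or a path, and for each component that is a generalized star, $i$ is adjacent only to its center among that component's vertices. *)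

(* Defs.v *)
From HB Require Import structures.
From mathcomp Require Export all_boot all_order all_algebra.
From mathcomp Require Export reals.

Set Implicit Arguments.
Unset Strict Implicit.
Unset Printing Implicit Defensive.

Import GRing.Theory.

Local Open Scope ring_scope.

Record sgraph (n : nat) := SGraph {
  adj :> rel 'I_n;
  adj_sym : symmetric adj;
  adj_irr : irreflexive adj }.

Section Graphs.
Variables (n : nat) (G : sgraph n).
Implicit Types (S : {set 'I_n}) (i c x y : 'I_n).

(* Subgraphs occur only as induced subgraphs G[S]; G - i is G[[set~ i]]. *)
Definition induced S : rel 'I_n :=
  [rel x y | [&& x \in S, y \in S & G x y]].

Definition components S : {set {set 'I_n}} :=
  [set [set y in S | connect (induced S) x y] | x in S].

Definition connected S : Prop :=
  S != set0 /\ {in S &, forall x y, connect (induced S) x y}.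

Definition degree S x : nat := #|[set y in S | G x y]|.

(* [ucycle] also holds for [::] and for [:: x; y] with x, y adjacent, whence
   the bound on the size. *)
Definition acyclic S : Prop :=
  forall p : seq 'I_n, ucycle (induced S) p -> (size p < 3)%N.

Definition is_tree S : Prop := connected S /\ acyclic S.

Definition is_path S : Prop :=
  exists (m : nat) (f : 'I_m -> 'I_n),
    [/\ (0 < m)%N, injective f, S = [set f j | j in 'I_m] &
        forall j k : 'I_m, G (f j) (f k) = (j.+1 == k) || (k.+1 == j)].

Definition high_degree S c : Prop := c \in S /\ (3 <= degree S c)%N.

Definition is_generalized_star S : Prop :=
  is_tree S /\ exists! c, high_degree S c.

Definition is_center S c : Prop :=
  is_generalized_star S /\ high_degree S c.

Definition is_yam i : Prop :=
  connected setT /\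
  forall C, C \in components [set~ i] ->
    (is_generalized_star C \/ is_path C) /\
    (is_generalized_star C -> {in C, forall x, G i x <-> is_center C x}).

End Graphs.

Section NullityPairs.
Variable R : realType.

Definition in_SG n (G : sgraph n) (A : 'M[R]_n) : Prop :=
  A^T = A /\ forall j k : 'I_n, j != k -> (A j k != 0) = G j k.

(* [kermx] is the left kernel, so the transpose gives dim {x | A x = 0}. *)
Definition nullity n (A : 'M[R]_n) : nat := \rank (kermx A^T).

Definition del_rc n (A : 'M[R]_n) (i : 'I_n) : 'M[R]_n.-1 := row' i (col' i A).

Definition allows_nullity_pair n (G : sgraph n) (i : 'I_n) (k l : nat) : Prop :=
  exists A : 'M[R]_n,
    in_SG G A /\ (nullity A, nullity (del_rc A i)) = (k, l).

End NullityPairs.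

(* Main.v *)
Require Import Defs.
From mathcomp Require Import boolp ring zify.

Set Implicit Arguments.
Unset Strict Implicit.
Unset Printing Implicit Defensive.

Import Order.TTheory GRing.Theory Num.Theory.

Local Open Scope ring_scope.

(** Let S be the vertex set of G - i. Deleting row and column [i] of [A] raises
    the nullity by one iff some kernel vector of A[S] is not orthogonal to the
    row of [A] at [i]. Only the support of that row is prescribed, so (1, 2)
    occurs iff some matrix with graph G[S] has nullity 2 and a kernel vector that
    does not vanish at some neighbour [j] of [i]. For a given [j] in S such a
    matrix exists unless G[S] is a path or a generalized star centered at [j].

    If G[S] is disconnected, take Laplacians on two components and positive
    definite matrices on the others. If it is connected with a cycle, give a
    suitable negative weight to one edge of the cycle in the Laplacian. If it is
    a tree with a vertex [c <> j] of degree at least 3, the same kind of matrix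
    on G[S] - c, with nullity 3 supported by three branches at [c], loses one
    dimension of kernel when it is bordered by an all-ones row at [c].

    Conversely, a kernel vector of a path vanishing at an end vertex is zero. On
    a generalized star, nullity 2 yields a nonzero kernel vector vanishing at the
    center; one of its branches, tested against any other kernel vector, shows
    that the latter vanishes at the center too. *)

(** * Kernels of principal submatrices *)

Lemma sum_delta (R : pzRingType) (I : finType) (i : I) (x : I -> R) :
  \sum_j (j == i)%:R * x j = x i.
Proof.
by rewrite (bigD1 i) //= eqxx mul1r big1 ?addr0 // => j /negPf->; rewrite mul0r.
Qed.

Section MatrixVector.
Variables (R : comPzRingType) (n : nat).
Implicit Types (M : 'M[R]_n) (x v : 'I_n -> R).

Definition mulmv M x y : R := \sum_z M y z * x z.

Lemma mulmvB M x v y :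
  mulmv M (fun z => x z - v z) y = mulmv M x y - mulmv M v y.
Proof. by rewrite -sumrB; apply: eq_bigr => z _; rewrite mulrBr. Qed.

Lemma mulmv_pairing M x v : M^T = M ->
  \sum_y v y * mulmv M x y = \sum_y x y * mulmv M v y.
Proof.
move=> symM; under eq_bigr do rewrite mulr_sumr.
under [RHS]eq_bigr do rewrite mulr_sumr.
rewrite exchange_big; apply: eq_bigr => y _; apply: eq_bigr => z _.
by rewrite -{1}symM mxE; ring.
Qed.

End MatrixVector.

Section KernelOn.
Variables (F : fieldType) (n : nat).
Implicit Types (M : 'M[F]_n) (S P : {set 'I_n}) (x v d : 'I_n -> F) (c : 'I_n).

(* [in_ker S M] is the kernel of the principal submatrix M[S], with vectors
   extended by zero outside S. *)
Definition in_ker S M x : Prop :=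
  (forall y, y \notin S -> x y = 0) /\ (forall y, y \in S -> mulmv M x y = 0).

Definition ker_on S M : 'M[F]_n :=
  kermx (\matrix_(z, y) if y \in S then M y z else (z == y)%:R).

Definition nullity_on S M : nat := \rank (ker_on S M).

Lemma in_kerP S M (x : 'rV[F]_n) :
  reflect (in_ker S M (x 0)) (x <= ker_on S M)%MS.
Proof.
have entry y : (x *m \matrix_(z, y) if y \in S then M y z else (z == y)%:R) 0 y
    = if y \in S then mulmv M (x 0) y else x 0 y.
  rewrite mxE; under eq_bigr do rewrite mxE mulrC; case: ifP => // _.
  exact: sum_delta.
apply: (iffP sub_kermxP) => [/rowP x0|[x_out x_ker]].
  by split=> y yS; have := x0 y; rewrite entry mxE ?yS // (negPf yS).
by apply/rowP => y; rewrite entry [RHS]mxE; case: ifPn => [/x_ker|/x_out].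
Qed.

Lemma nullity_on_vanish S M P : (#|P| < nullity_on S M)%N ->
  exists x, [/\ in_ker S M x, {in P, forall y, x y = 0} & exists y, x y != 0].
Proof.
move=> ltP; pose E : 'M[F]_(n, #|P|) := colsub enum_val 1%:M.
pose w := nz_row (ker_on S M :&: kermx E)%MS.
have w_neq0 : w != 0.
  rewrite nz_row_eq0 -mxrank_eq0 -lt0n -(ltn_add2l (\rank (ker_on S M *m E))).
  by rewrite mxrank_mul_ker addn0 (leq_ltn_trans (rank_leq_col _)).
have : (w <= ker_on S M :&: kermx E)%MS by exact: nz_row_sub.
rewrite sub_capmx => /andP[/in_kerP kw /sub_kermxP/rowP wE].
exists (w 0); split=> // [y yP|].
  have := wE (enum_rank_in yP y).
  by rewrite mulmx_colsub mulmx1 !mxE enum_rankK_in.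
by have /rV0Pn := w_neq0.
Qed.

Lemma nullity_on_le_card S M P :
  (forall x, in_ker S M x -> {in P, forall y, x y = 0} -> forall y, x y = 0) ->
  (nullity_on S M <= #|P|)%N.
Proof.
move=> forcing; rewrite leqNgt; apply/negP => /nullity_on_vanish[x [kx xP [y]]].
by rewrite forcing ?eqxx.
Qed.

Lemma card_le_nullity_on S M P (u : 'I_n -> 'I_n -> F) :
  {in P, forall p, in_ker S M (u p)} ->
  {in P &, forall p q, (u p q != 0) = (p == q)} ->
  (#|P| <= nullity_on S M)%N.
Proof.
move=> ku u_dual; pose U : 'M[F]_(#|P|, n) := \matrix_(k, z) u (enum_val k) z.
have /eqP <- : row_free U.
  rewrite -kermx_eq0; apply/rowV0P => w /sub_kermxP/rowP wU0.
  apply/rowP => k; have /eqP := wU0 (enum_val k); rewrite mxE (bigD1 k) //=.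
  rewrite big1 ?addr0 => [|l lk].
    by rewrite mxE [X in _ == X]mxE mulf_eq0 -[X in _ || X]negbK u_dual
      ?enum_valP ?eqxx ?orbF // => /eqP->; rewrite mxE.
  rewrite mxE; apply/eqP; rewrite mulf_eq0 -[X in _ || X]negbK.
  by rewrite u_dual ?enum_valP // (inj_eq enum_val_inj) lk orbT.
apply/mxrankS/row_subP => k; apply/in_kerP.
have -> : row k U 0 = u (enum_val k) by apply/funext => z; rewrite !mxE.
exact/ku/enum_valP.
Qed.

Lemma mulmv_solvable M d :
  (forall x, (forall z, mulmv M^T x z = 0) -> \sum_y d y * x y = 0) ->
  exists y, forall z, mulmv M y z = d z.
Proof.
move=> orth; have : (\row_z d z <= M^T)%MS.
  rewrite submxE; apply/eqP/rowP => k; rewrite mxE [RHS]mxE.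
  under eq_bigr do rewrite mxE; apply: orth => z.
  by have /matrixP/(_ z k) := mulmx_coker M^T; rewrite mxE [RHS]mxE.
move=> /submxP[w /rowP dE]; exists (w 0) => z; have := dE z; rewrite !mxE => ->.
by apply: eq_bigr => t _; rewrite mxE mulrC.
Qed.

Lemma in_kerB S M x v : in_ker S M x -> in_ker S M v ->
  in_ker S M (fun z => x z - v z).
Proof.
move=> [x_out x_ker] [v_out v_ker]; split=> y yS.
  by rewrite x_out ?v_out ?subrr.
by rewrite mulmvB x_ker ?v_ker ?subrr.
Qed.

Lemma in_kerD1P S M x c : c \in S ->
  in_ker S M x /\ x c = 0 <-> in_ker (S :\ c) M x /\ mulmv M x c = 0.
Proof.
move=> cS; split=> [[[x_out x_ker] xc]|[[x_out x_ker] xc]].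
  split; last exact: x_ker.
  split=> y; rewrite in_setD1; last by case/andP=> _; exact: x_ker.
  by rewrite negb_and negbK => /orP[/eqP->|/x_out].
split; last by rewrite x_out // setD11.
split=> y yS; first by rewrite x_out // in_setD1 negb_and yS orbT.
by have [->//|yc] := eqVneq y c; rewrite x_ker // in_setD1 yc.
Qed.

Lemma in_ker_pairing S M x v c : M^T = M ->
  in_ker S M x -> in_ker (S :\ c) M v -> x c * mulmv M v c = 0.
Proof.
move=> symM [x_out x_ker] [v_out v_ker].
transitivity (\sum_y x y * mulmv M v y).
  rewrite (bigD1 c) //= big1 ?addr0 // => y yc.
  have [yS|yS] := boolP (y \in S); last by rewrite x_out ?mul0r.
  by rewrite v_ker ?mulr0 // in_setD1 yc.
rewrite -mulmv_pairing //; apply: big1 => y _.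
have [yS|yS] := boolP (y \in S); first by rewrite x_ker ?mulr0.
by rewrite v_out ?mul0r // in_setD1 negb_and yS orbT.
Qed.

Lemma mulmx_tr_row M c (x : 'rV[F]_n) :
  x *m (row c M)^T = (mulmv M (x 0) c)%:M.
Proof.
apply/rowP => k; rewrite ord1 !mxE mulr1n.
by apply: eq_bigr => z _; rewrite !mxE mulrC.
Qed.

Lemma nullity_onD1 S M c v : M^T = M -> c \in S ->
  in_ker (S :\ c) M v -> mulmv M v c != 0 ->
  nullity_on (S :\ c) M = (nullity_on S M).+1.
Proof.
move=> symM cS kv vc; pose f := (row c M)^T.
have f_onto : \rank (ker_on (S :\ c) M *m f) = 1%N.
  apply/eqP; rewrite eqn_leq rank_leq_col lt0n mxrank_eq0.
  apply: contra vc => /eqP kerf0.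
  have v_row : (\row_z v z) 0 = v by apply/funext => z; rewrite mxE.
  have /submxP[w vE] : (\row_z v z <= ker_on (S :\ c) M)%MS.
    by apply/in_kerP; rewrite v_row.
  have : \row_z v z *m f = 0 by rewrite vE -mulmxA kerf0 mulmx0.
  by rewrite mulmx_tr_row v_row => /rowP/(_ 0); rewrite !mxE mulr1n => ->.
suff kerE : (ker_on S M == ker_on (S :\ c) M :&: kermx f)%MS.
  by rewrite /nullity_on (eqmxP kerE) -[LHS](mxrank_mul_ker _ f) f_onto.
apply/rV_eqP => x; rewrite sub_capmx; apply/in_kerP/andP => [kx|[]].
  have xc : x 0 c = 0.
    have /eqP := in_ker_pairing symM kx kv.
    by rewrite mulf_eq0 (negPf vc) orbF => /eqP.
  have [/in_kerP kx' xf] := (in_kerD1P M (x 0) cS).1 (conj kx xc).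
  by split=> //; apply/sub_kermxP; rewrite mulmx_tr_row xf raddf0.
move=> /in_kerP kx /sub_kermxP; rewrite mulmx_tr_row => /rowP/(_ 0).
rewrite !mxE mulr1n => xf.
by have [] := (in_kerD1P M (x 0) cS).2 (conj kx xf).
Qed.

(* The vertices satisfying this equivalence are known as Parter vertices. *)
Lemma nullity_onD1P S M c : M^T = M -> c \in S ->
  nullity_on (S :\ c) M = (nullity_on S M).+1 <->
  exists2 v, in_ker (S :\ c) M v & mulmv M v c != 0.
Proof.
move=> symM cS; split=> [nullE|[v]]; last exact: nullity_onD1.
apply: contrapT => row_orth; suff : (ker_on (S :\ c) M <= ker_on S M)%MS.
  by move/mxrankS; rewrite -/(nullity_on _ _) nullE ltnn.
apply/rV_subP => x /in_kerP kx; apply/in_kerP.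
have [//|//] := (in_kerD1P M (x 0) cS).2; split=> //.
by apply: contrapT => /eqP xc; apply: row_orth; exists (x 0).
Qed.

End KernelOn.

Lemma nullity_on_setT (R : realType) n (A : 'M[R]_n) :
  nullity_on setT A = nullity A.
Proof.
rewrite /nullity_on /ker_on /nullity; congr (\rank (kermx _)).
by apply/matrixP => y z; rewrite !mxE in_setT.
Qed.

Lemma in_ker_setC1 (F : fieldType) n (A : 'M[F]_n.+1) (i : 'I_n.+1) x :
  in_ker [set~ i] A x <->
  x i = 0 /\ in_ker setT (row' i (col' i A)) (x \o lift i).
Proof.
have rowE y : x i = 0 ->
    mulmv A x (lift i y) = mulmv (row' i (col' i A)) (x \o lift i) y.
  move=> xi; rewrite /mulmv (bigD1_ord i) //= xi mulr0 add0r.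
  by apply: eq_bigr => k _; rewrite !mxE.
split=> [[x_out x_ker]|[xi [_ x_ker]]].
  have xi : x i = 0 by rewrite x_out // !inE eqxx.
  split=> //; split=> y; first by rewrite inE.
  by rewrite -rowE // x_ker // !inE eq_sym neq_lift.
split=> y; rewrite !inE; first by rewrite negbK => /eqP->.
by case: (unliftP i y) => [k ->|->]; rewrite ?eqxx // rowE // x_ker.
Qed.

Lemma nullity_on_del_rc (R : realType) n (A : 'M[R]_n) (i : 'I_n) :
  nullity_on [set~ i] A = nullity (del_rc A i).
Proof.
case: n A i => [|n] A i; first by case: i.
pose P : 'M[R]_(n, n.+1) := row' i 1%:M.
have mulP (w : 'rV[R]_n) : (w *m P) 0 i = 0 /\ (w *m P) 0 \o lift i =1 w 0.
  split.
    rewrite mxE big1 // => l _.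
    by rewrite !mxE eq_sym (negPf (neq_lift i l)) mulr0.
  move=> k; rewrite /= mxE (bigD1 k) //= !mxE eqxx mulr1 big1 ?addr0 // => l lk.
  by rewrite !mxE (inj_eq lift_inj) (negPf lk) mulr0.
have freeP : row_free P.
  rewrite -kermx_eq0; apply/rowV0P => w /sub_kermxP/rowP wP0.
  by apply/rowP => k; have [_ <-] := mulP w; rewrite /= wP0 !mxE.
rewrite -nullity_on_setT /nullity_on -(mxrankMfree _ freeP).
apply/eqP; rewrite eqn_leq; apply/andP; split; apply/mxrankS/row_subP => k.
  move: (row k _) (row_sub k (ker_on [set~ i] A)) => x /in_kerP/in_ker_setC1[xi kx].
  have -> : x = (\row_l x 0 (lift i l)) *m P.
    apply/rowP => t; have [yi yl] := mulP (\row_l x 0 (lift i l)).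
    case: (unliftP i t) => [l ->|->]; last by rewrite [RHS]yi.
    by rewrite [RHS]yl mxE.
  apply/submxMr/in_kerP; congr in_ker: kx.
  by apply/funext => l; rewrite [RHS]mxE.
rewrite row_mul; apply/in_kerP/in_ker_setC1.
have [-> /funext->] := mulP (row k (ker_on setT (del_rc A i))).
by split=> //; apply/in_kerP/row_sub.
Qed.

(** * Induced subgraphs, trees and paths *)

Definition edge_between (T : eqType) (u v : T) : rel T :=
  [rel y z | (y == u) && (z == v) || (y == v) && (z == u)].

Definition delete_edge (T : eqType) (e : rel T) (u v : T) : rel T :=
  [rel y z | e y z && ~~ edge_between u v y z].

Lemma edge_between_sym (T : eqType) (u v : T) : symmetric (edge_between u v).
Proof.
by move=> y z; rewrite /edge_between /= orbC andbC [X in _ || X]andbC.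
Qed.

Lemma delete_edge_sym (T : eqType) (e : rel T) (u v : T) :
  symmetric e -> symmetric (delete_edge e u v).
Proof.
by move=> e_sym y z; rewrite /delete_edge [LHS]/= e_sym edge_between_sym.
Qed.

Lemma connect_delete_edge (T : finType) (e : rel T) (u v : T) : symmetric e ->
  connect (delete_edge e u v) u v ->
  subrel (connect e) (connect (delete_edge e u v)).
Proof.
move=> e_sym uv; apply: connect_sub => y z yz.
have [|yz'] := boolP (edge_between u v y z); last first.
  by apply: connect1; rewrite /delete_edge /= yz.
case/orP=> /andP[/eqP-> /eqP->] //.
by rewrite (sym_connect_sym (delete_edge_sym u v e_sym)).
Qed.

Definition component_indicator (R : pzRingType) (T : finType) (e : rel T)
  (a y : T) : R := (connect e a y)%:R.

Section InducedSubgraphs.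
Variables (n : nat) (G : sgraph n).
Implicit Types (S : {set 'I_n}) (a b c x y z : 'I_n).

Definition separates S c : Prop :=
  forall a b, induced G S c a -> induced G S c b -> a != b ->
    ~~ connect (induced G (S :\ c)) a b.

Lemma induced_sym S : symmetric (induced G S).
Proof. by move=> x y; rewrite /induced /= adj_sym andbCA. Qed.

Lemma induced_connect_sym S : connect_sym (induced G S).
Proof. exact/sym_connect_sym/induced_sym. Qed.

Lemma connect_induced_mem S x y :
  x \in S -> connect (induced G S) x y -> y \in S.
Proof.
move=> xS /connectP[p + ->]; elim: p x xS => //= z p IHp x _.
by case/andP=> /and3P[_ zS _]; apply: IHp.
Qed.

Lemma induced_mem_D1 S c a : induced G S c a -> a \in S :\ c.
Proof.
case/and3P=> _ aS Gca; rewrite in_setD1 aS andbT.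
by apply: contraTneq Gca => ->; rewrite adj_irr.
Qed.

Lemma connect_first_step S c x : connect (induced G S) c x -> x != c ->
  exists a q, [/\ induced G S c a, path (induced G (S :\ c)) a q,
                  uniq [:: c, a & q] & x = last a q].
Proof.
move=> /connectP[p0 /shortenP[p ep up _] ->].
case: p ep up => [|a q] /=; first by rewrite eqxx.
move=> /andP[ca aq] up _; exists a, q; split=> //.
move: up => /andP[c_notin _]; elim: q a {ca} aq c_notin => //= b q IHq a.
case/andP=> /and3P[aS bS ab] bq; rewrite !inE !negb_or => /and3P[ca cb cq].
rewrite /induced /= !inE aS bS ab ![_ == c]eq_sym ca cb /=; apply: IHq => //.
by rewrite inE negb_or cb.
Qed.

Lemma connectedT_neighbor c x : connected G setT -> x != c -> exists a, G c a.
Proof.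
move=> [_ con] xc.
have cx : connect (induced G setT) c x by apply: con; rewrite inE.
have [a [_ [/and3P[_ _ ca] _ _ _]]] := connect_first_step cx xc.
by exists a.
Qed.

Lemma connected_components S : connected G S -> components G S = [set S].
Proof.
move=> [/set0Pn[x xS] con]; have comp y : y \in S ->
    [set z in S | connect (induced G S) y z] = S.
  move=> yS; apply/setP => z; rewrite inE.
  by case: (boolP (z \in S)) => //= zS; exact: con.
apply/setP => C; rewrite inE; apply/imsetP/eqP => [[y yS ->]|->]; first exact: comp.
by exists x; rewrite ?comp.
Qed.

Lemma components_le1_connected S :
  S != set0 -> (#|components G S| <= 1)%N -> connected G S.
Proof.
move=> S_neq0 /card_le1_eqP all_eq; split=> // y z yS zS.
pose comp x := [set t in S | connect (induced G S) x t].
have /setP/(_ z) : comp y = comp z by apply: all_eq; apply: imset_f.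
by rewrite !inE zS connect0.
Qed.

Lemma acyclic_separates S c : acyclic G S -> separates S c.
Proof.
move=> acyc a b ca cb ab; apply/negP => /connectP[p0 /shortenP[p ep up _] bE].
have path_S x q : path (induced G (S :\ c)) x q -> path (induced G S) x q.
  apply: sub_path => y z /and3P[]; rewrite !inE => /andP[_ yS] /andP[_ zS] yz.
  by rewrite /induced /= yS zS.
have path_avoids q x : x != c -> path (induced G (S :\ c)) x q -> c \notin x :: q.
  elim: q x => [|y q IHq] x xc; first by rewrite inE eq_sym.
  case/andP=> /and3P[_ /setD1P[yc _] _] /(IHq _ yc).
  by rewrite [in X in _ -> X]inE negb_or eq_sym xc.
have /setD1P[ac _] := induced_mem_D1 ca.
have /acyc : ucycle (induced G S) [:: c, a & p].
  rewrite /ucycle /= rcons_path ca path_S //= -bE induced_sym cb /=.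
  by rewrite path_avoids.
by case: p ep up bE => //= _ _ ba; rewrite ba eqxx in ab.
Qed.

Lemma not_acyclic_nonbridge S : ~ acyclic G S ->
  exists u v, induced G S u v /\ connect (delete_edge (induced G S) u v) u v.
Proof.
move/existsNP=> [p /not_implyP[+ /negP]]; rewrite -leqNgt.
case: p => [|u [|v [|w q]]] // cyc _; exists u, v.
move: cyc => /andP[/=]; rewrite rcons_path => /and4P[uv vw wq last_u].
rewrite !inE !negb_or => /and3P[/and3P[u_v uw uq] /andP[v_w vq] _].
split=> //; rewrite (sym_connect_sym (delete_edge_sym _ _ (@induced_sym S))).
apply: (@connect_trans _ _ (last w q)); last first.
  apply: connect1; rewrite /delete_edge /edge_between /= last_u eqxx andbT /=.
  have last_v : last w q != v.
    by apply: contraTneq (mem_last w q) => ->; rewrite inE negb_or v_w.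
  by rewrite (negPf last_v) eq_sym (negPf u_v) /= andbF.
apply/connectP; exists (w :: q) => //.
apply: (@sub_in_path _ (predC1 u) (induced G S)).
- move=> y z; rewrite /delete_edge /edge_between !inE /= => /negPf yu /negPf zu ->.
  by rewrite yu zu andbF.
- rewrite /= ![_ == u]eq_sym u_v uw /=.
  by apply/allP => y yq; apply: contraNneq uq => <-.
- by rewrite /= vw.
Qed.

Lemma neighbor_in_setC1 c a : G c a -> a \in [set~ c].
Proof. by rewrite !inE; apply: contraTneq => ->; rewrite adj_irr. Qed.

Lemma high_degree_center S c y :
  is_center G S c -> high_degree G S y -> y = c.
Proof. by move=> [[_ [z [_ z_uniq]]] /z_uniq <-] /z_uniq. Qed.

Lemma is_path_connected S : is_path G S -> connected G S.
Proof.
case=> m [f [m_gt0 _ SE fG]].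
have fS k : f k \in S by rewrite SE imset_f.
have connect_first p (pm : (p < m)%N) :
    connect (induced G S) (f (Ordinal m_gt0)) (f (Ordinal pm)).
  elim: p pm => [|p IHp] pm; first by rewrite (bool_irrelevance pm m_gt0) connect0.
  apply: connect_trans (IHp (ltnW pm)) (connect1 _).
  by rewrite /induced /= !fS fG /= eqxx.
split; first by apply/set0Pn; exists (f (Ordinal m_gt0)).
move=> y z; rewrite {1 2}SE => /imsetP[[k km] _ ->] /imsetP[[l lm] _ ->].
by apply: connect_trans (connect_first l lm); rewrite induced_connect_sym.
Qed.

Lemma is_path_degree_le2 S x : is_path G S -> x \in S -> (degree G S x <= 2)%N.
Proof.
case=> m [f [_ f_inj SE fG]]; rewrite {1}SE => /imsetP[j _ ->].
rewrite leqNgt; apply/negP => /card_gt2P[y1 [y2 [y3 [[]]]]].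
rewrite !inE SE => /andP[/imsetP[k1 _ ->] jk1] /andP[/imsetP[k2 _ ->] jk2].
move=> /andP[/imsetP[k3 _ ->] jk3]; rewrite !(inj_eq f_inj).
by move: jk1 jk2 jk3; rewrite !fG -!val_eqE /= => ? ? ? [? ? ?]; lia.
Qed.

Lemma generalized_star_not_path S : is_generalized_star G S -> ~ is_path G S.
Proof.
move=> [_ [c [[cS c3] _]]] pathS.
by have := is_path_degree_le2 pathS cS; rewrite leqNgt c3.
Qed.

End InducedSubgraphs.

Section SimplePaths.
Variables (n : nat) (G : sgraph n) (S : {set 'I_n}).
Implicit Types (s : seq 'I_n) (x : 'I_n).
Local Notation e := (induced G S).

Definition simple_path s : bool := [&& sorted e s, uniq s & all [in S] s].

Lemma simple_path_size s : simple_path s -> (size s <= n)%N.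
Proof.
by case/and3P=> _ /card_uniqP <- _; rewrite -[leqRHS]card_ord max_card.
Qed.

Lemma exists_longest_simple_path x : x \in S ->
  exists2 s, simple_path s & (0 < size s)%N /\
    forall t, simple_path t -> (size t <= size s)%N.
Proof.
move=> xS; pose has_length k := `[< exists2 s, simple_path s & size s = k >].
have x1 : has_length 1.
  by apply/asboolP; exists [:: x] => //; rewrite /simple_path /= xS.
have bounded k : has_length k -> (k <= n)%N.
  by move=> /asboolP[s /simple_path_size + <-].
have ex_length : exists k, has_length k by exists 1%N.
case: (ex_maxnP ex_length bounded) => m /asboolP[s sP sizeE] maxm.
have longest t : simple_path t -> (size t <= m)%N.
  by move=> tP; apply/maxm/asboolP; exists t.
by exists s; rewrite // sizeE; split=> //; apply: maxm.
Qed.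

Lemma longest_simple_path_closed s a b :
  (forall x, x \in S -> (degree G S x <= 2)%N) -> simple_path s ->
  (forall t, simple_path t -> (size t <= size s)%N) ->
  a \in s -> e a b -> b \in s.
Proof.
move=> deg2 sP longest as_ ab; apply: contraT => bs.
have /and3P[aS bS Gab] := ab; have ba : e b a by rewrite induced_sym.
have no_extension t : simple_path t -> size t = (size s).+1 -> false.
  by move=> /longest + sizeE; rewrite sizeE ltnn.
have /and3P[s_sorted s_uniq s_S] := sP.
case/splitPr: as_ s_sorted s_uniq s_S bs no_extension {sP longest} => s1 s2.
rewrite sorted_cat_cons.
case/lastP: s1 => [|s1 p] /andP[s1a as2] s_uniq s_S bs no_extension.
  apply: (no_extension [:: b, a & s2]) => //.
  by apply/and3P; split; rewrite /= ?ba ?bs ?bS.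
case: s2 => [|q s2] in as2 s_uniq s_S bs no_extension *.
  have catE : rcons s1 p ++ [:: a; b] = rcons (rcons s1 p ++ [:: a]) b.
    by rewrite -[RHS]cats1 -catA.
  apply: (no_extension (rcons s1 p ++ [:: a; b])); last by rewrite catE size_rcons.
  apply/and3P; split; first by rewrite sorted_cat_cons s1a /= ab.
    by rewrite catE rcons_uniq bs.
  by rewrite catE all_rcons /= bS.
have /andP[/and3P[pS _ Gpa] /and3P[_ qS Gaq]] : e p a && e a q.
  move: s1a as2; rewrite -cats1 -cats1 -catA sorted_cat_cons /=.
  by case/and3P=> _ -> _ /andP[].
have := deg2 a aS; rewrite leqNgt => /negP[]; apply/card_gt2P.
exists p, q, b; rewrite !inE pS qS bS adj_sym Gpa Gaq Gab; split=> //.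
move: s_uniq bs; rewrite cat_uniq mem_cat mem_rcons !inE !negb_or /=.
case/and3P=> _ /and3P[_ q_s1p _] _ /and4P[/andP[bp _] _ bq _].
move: q_s1p; rewrite mem_rcons inE negb_or => /andP[qp _].
by rewrite eq_sym qp eq_sym bq bp.
Qed.

Lemma acyclic_no_chord s x0 j k : acyclic G S -> simple_path s ->
  (j < k < size s)%N -> e (nth x0 s j) (nth x0 s k) -> k = j.+1.
Proof.
move=> acyc /and3P[s_sorted s_uniq _] /andP[jk ks] chord; apply/eqP.
rewrite eqn_leq jk andbT leqNgt; apply/negP => jk1.
pose q := take (k - j) (drop j.+1 s).
have size_q : size q = (k - j)%N by rewrite size_takel // size_drop; lia.
have qE : nth x0 s j :: q = take (k - j).+1 (drop j s).
  by rewrite [in RHS](drop_nth x0) //; lia.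
suff /acyc : ucycle e (nth x0 s j :: q) by rewrite /= size_q; lia.
apply/andP; split; last by rewrite qE take_uniq // drop_uniq.
have : sorted e (nth x0 s j :: q) by rewrite qE take_sorted // drop_sorted.
rewrite /= rcons_path => ->; rewrite (last_nth x0) size_q /=.
rewrite qE nth_take // nth_drop subnKC 1?ltnW //.
by rewrite induced_sym.
Qed.

Lemma simple_path_is_path s : acyclic G S -> simple_path s -> (0 < size s)%N ->
  is_path G [set x in s].
Proof.
move=> acyc sP s_gt0; have x0 : 'I_n by case: s sP s_gt0.
have /and3P[s_sorted s_uniq /allP s_S] := sP.
have consecutive j k : (j < k < size s)%N ->
    G (nth x0 s j) (nth x0 s k) = (j.+1 == k).
  move=> /[dup] jks /andP[jk ks]; have js := ltn_trans jk ks.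
  apply/idP/eqP => [jkG|kE].
    apply/esym/(acyclic_no_chord (x0 := x0) acyc sP) => //.
    by rewrite /induced /= !s_S ?mem_nth.
  by have /(sortedP x0)/(_ j) := s_sorted; rewrite kE => /(_ ks)/and3P[].
exists (size s), (fun j => nth x0 s j); split=> //.
- by move=> j k /eqP; rewrite nth_uniq // => /eqP/val_inj.
- apply/setP => z; rewrite inE.
  apply/idP/imsetP => [zs|[j _ ->]]; last exact: mem_nth.
  have zk : (index z s < size s)%N by rewrite index_mem.
  by exists (Ordinal zk) => //=; rewrite nth_index.
move=> j k; case: (ltngtP j k) => [jk|kj|/val_inj->].
- by rewrite consecutive ?jk //= (_ : (k.+1 == j) = false) ?orbF //; lia.
- by rewrite adj_sym consecutive ?kj //= (_ : (j.+1 == k) = false) //; lia.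
- by rewrite adj_irr orbb; lia.
Qed.

Lemma acyclic_degree2_is_path : connected G S -> acyclic G S ->
  (forall x, x \in S -> (degree G S x <= 2)%N) -> is_path G S.
Proof.
move=> [/set0Pn[x0 x0S] con] acyc deg2.
have [s sP [s_gt0 longest]] := exists_longest_simple_path x0S.
suff -> : S = [set x in s] by exact: simple_path_is_path.
have /and3P[_ _ /allP s_S] := sP.
apply/setP => z; rewrite inE; apply/idP/idP => [zS|]; last exact: s_S.
have x_s : nth x0 s 0 \in s by exact: mem_nth.
have /connectP[p ep ->] := con _ _ (s_S _ x_s) zS.
elim: p (nth x0 s 0) x_s ep => //= y p IHp x xs /andP[xy /IHp]; apply.
exact: longest_simple_path_closed xy.
Qed.

End SimplePaths.

(** * Laplacians *)

Section Laplacian.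
Variables (R : realFieldType) (T : finType).
Implicit Types (w : T -> T -> R) (e : rel T) (x f D : T -> R) (A : {set T}).

Definition lap w x y : R := \sum_z w y z * (x y - x z).

Definition unit_weight e y z : R := (e y z)%:R.

Definition supported_on A w : Prop :=
  forall y z, w y z != 0 -> (y \in A) && (z \in A).

Lemma unit_weight_neq0 e y z : (unit_weight e y z != 0) = e y z.
Proof. by rewrite pnatr_eq0 eqb0 negbK. Qed.

Lemma unit_weight_sym e : symmetric e ->
  forall y z, unit_weight e y z = unit_weight e z y.
Proof. by move=> e_sym y z; rewrite /unit_weight e_sym. Qed.

Lemma lap_const w x y : (forall z, w y z != 0 -> x y = x z) -> lap w x y = 0.
Proof.
move=> cst; apply: big1 => z _.
by have [->|/cst->] := eqVneq (w y z) 0; rewrite ?mul0r // subrr mulr0.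
Qed.

Lemma lap_unit_const e x y : (forall z, e y z -> x y = x z) ->
  lap (unit_weight e) x y = 0.
Proof.
by move=> cst; apply: lap_const => z; rewrite unit_weight_neq0 => /cst.
Qed.

Lemma lap_subC w x a : lap w (fun z => x z - a) =1 lap w x.
Proof. by move=> y; apply: eq_bigr => z _; congr (_ * _); ring. Qed.

Lemma lap_restrict A w x : supported_on A w ->
  lap w (fun z => (z \in A)%:R * x z) =1 lap w x.
Proof.
move=> w_supp y; apply: eq_bigr => z _.
have [->|/w_supp/andP[-> ->]] := eqVneq (w y z) 0; first by rewrite !mul0r.
by rewrite !mul1r.
Qed.

Lemma lap_green w f x : (forall y z, w y z = w z y) ->
  2 * (\sum_y f y * lap w x y) =
  \sum_y \sum_z w y z * (f y - f z) * (x y - x z).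
Proof.
move=> w_sym.
have swap : \sum_y f y * lap w x y = \sum_y \sum_z f z * w y z * (x z - x y).
  rewrite exchange_big; apply: eq_bigr => y _; rewrite mulr_sumr.
  by apply: eq_bigr => z _; rewrite w_sym mulrA.
rewrite mulr2n mulrDl mul1r {2}swap -big_split; apply: eq_bigr => y _ /=.
by rewrite mulr_sumr -big_split; apply: eq_bigr => z _ /=; ring.
Qed.

Section UnitWeight.
Variable e : rel T.
Hypothesis e_sym : symmetric e.
Local Notation lape := (lap (unit_weight e)).

Lemma lap_energy_le0_const x : \sum_y x y * lape x y <= 0 ->
  forall y z, connect e y z -> x y = x z.
Proof.
move=> energy_le0.
have term_ge0 y z : 0 <= (e y z)%:R * (x y - x z) * (x y - x z).
  by rewrite -mulrA -expr2 mulr_ge0 ?sqr_ge0.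
have sum_ge0 y : 0 <= \sum_z (e y z)%:R * (x y - x z) * (x y - x z).
  exact: sumr_ge0.
have energy0 : \sum_y \sum_z (e y z)%:R * (x y - x z) * (x y - x z) = 0.
  apply/eqP; rewrite eq_le sumr_ge0 // andbT.
  by rewrite -(lap_green _ _ (unit_weight_sym e_sym)) pmulr_rle0.
have edge_const y z : e y z -> x y = x z.
  have row0 := psumr_eq0P (fun y _ => sum_ge0 y) energy0 (i := y) isT.
  have /eqP := psumr_eq0P (fun z _ => term_ge0 y z) row0 (i := z) isT.
  by move=> + yz; rewrite yz mul1r mulf_eq0 orbb subr_eq0 => /eqP.
move=> y z /connectP[p ep ->].
by elim: p y ep => //= t p IHp y /andP[/edge_const-> /IHp].
Qed.

Lemma lap_add_potential_ker D x : (forall y, 0 <= D y) ->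
  (forall y, lape x y + D y * x y = 0) ->
  (forall y z, connect e y z -> x y = x z) /\ (forall y, D y * x y = 0).
Proof.
move=> D_ge0 ker.
have cst : forall y z, connect e y z -> x y = x z.
  apply: lap_energy_le0_const; apply: sumr_le0 => y _.
  have /eqP := ker y; rewrite addr_eq0 => /eqP->.
  by rewrite mulrN oppr_le0 mulrCA -expr2 mulr_ge0 ?sqr_ge0.
split=> // y; rewrite -[RHS](ker y) [lape _ _]lap_unit_const ?add0r // => z yz.
exact/cst/connect1.
Qed.

Lemma lap_component_indicator a y : lape (component_indicator R e a) y = 0.
Proof.
apply: lap_unit_const => z yz; congr (_%:R); congr nat_of_bool.
by apply: same_connect_r; [exact: sym_connect_sym | exact: connect1].
Qed.

(* With this potential the Laplacian is positive definite on the components that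
   miss [A]. *)
Definition killing A y : R := (~~ [exists a in A, connect e a y])%:R.

Lemma killing_component_indicator A a y : a \in A ->
  killing A y * component_indicator R e a y = 0.
Proof.
move=> aA; rewrite /killing /component_indicator -natrM mulnb.
case: (boolP (connect e a y)) => [ay|_]; last by rewrite andbF.
by rewrite andbT (_ : [exists b in A, _]) //; apply/exists_inP; exists a.
Qed.

Lemma lap_killing_eq0 A x : (forall y, lape x y + killing A y * x y = 0) ->
  {in A, forall a, x a = 0} -> forall y, x y = 0.
Proof.
move=> /(lap_add_potential_ker (fun y => ler0n R _))[cst killed] xA y.
have [/exists_inP[a aA /cst<-]|noA] := boolP [exists a in A, connect e a y].
  exact: xA.
by have := killed y; rewrite /killing noA mul1r.
Qed.

End UnitWeight.

Definition dipole (u v : T) z : R := (z == u)%:R - (z == v)%:R.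

Lemma sum_dipole u v x : \sum_z dipole u v z * x z = x u - x v.
Proof.
by under eq_bigr do rewrite /dipole mulrBl; rewrite sumrB !sum_delta.
Qed.

Definition reweight_edge e (u v : T) (t : R) y z : R :=
  unit_weight (delete_edge e u v) y z + t * unit_weight (edge_between u v) y z.

Lemma reweight_edge_sym e u v t : symmetric e ->
  forall y z, reweight_edge e u v t y z = reweight_edge e u v t z y.
Proof.
move=> e_sym y z; rewrite /reweight_edge.
by congr (_ + _ * _); apply: unit_weight_sym => //;
  [exact: delete_edge_sym | exact: edge_between_sym].
Qed.

Lemma reweight_edge_neq0 e u v t y z : symmetric e -> e u v -> t != 0 ->
  (reweight_edge e u v t y z != 0) = e y z.
Proof.
move=> e_sym uv t_neq0; rewrite /reweight_edge /unit_weight /delete_edge /=.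
case: (boolP (edge_between u v y z)) => [|_]; last first.
  by rewrite andbT mulr0 addr0 unit_weight_neq0.
by case/orP=> /andP[/eqP-> /eqP->]; rewrite andbF add0r mulr1 t_neq0 ?uv //
  e_sym uv.
Qed.

Lemma lap_edge_between u v x z : u != v ->
  lap (unit_weight (edge_between u v)) x z = (x u - x v) * dipole u v z.
Proof.
move=> uv; rewrite /lap /unit_weight /edge_between /dipole /=.
have [->|zu] := eqVneq z u.
  rewrite (negPf uv) subr0 mulr1 -[RHS](sum_delta v (fun t => x u - x t)).
  by apply: eq_bigr => t _; rewrite orbF.
have [->|zv] := eqVneq z v.
  rewrite sub0r mulrN1 opprB; exact: (sum_delta u (fun t => x v - x t)).
by rewrite subrr mulr0; apply: big1 => t _; rewrite mul0r.
Qed.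

Lemma lap_reweight_edge e u v t x z : u != v ->
  lap (reweight_edge e u v t) x z =
  lap (unit_weight (delete_edge e u v)) x z + t * (x u - x v) * dipole u v z.
Proof.
move=> uv; rewrite -mulrA -lap_edge_between // [X in _ + X]mulr_sumr -big_split.
by apply: eq_bigr => k _; rewrite mulrDl -mulrA.
Qed.

Lemma lap_reweight_edge_eq0_const e u v t x :
  symmetric e -> u != v -> connect (delete_edge e u v) u v ->
  (forall z, lap (reweight_edge e u v t) x z = 0) -> x u = x v ->
  forall y z, connect e y z -> x y = x z.
Proof.
move=> e_sym uv conn harmonic xuv y z /(connect_delete_edge e_sym conn).
apply: lap_energy_le0_const; first exact: delete_edge_sym.
rewrite big1 // => k _; have := harmonic k.
by rewrite lap_reweight_edge // xuv subrr mulr0 mul0r addr0 => ->; rewrite mulr0.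
Qed.

End Laplacian.

Section LaplacianMatrix.
Variables (R : realFieldType) (n : nat).
Implicit Types (w : 'I_n -> 'I_n -> R) (D x : 'I_n -> R) (S : {set 'I_n}).
Implicit Types (e : rel 'I_n) (u v : 'I_n).

Definition lapmx w D : 'M[R]_n :=
  \matrix_(y, z) ((y == z)%:R * (\sum_t w y t + D y) - w y z).

Lemma mulmv_lapmx w D x y : mulmv (lapmx w D) x y = lap w x y + D y * x y.
Proof.
rewrite /mulmv; under eq_bigr => z _ do rewrite mxE mulrBl -mulrA.
rewrite sumrB (bigD1 y) //= eqxx mul1r.
rewrite [X in _ + X - _]big1 ?addr0 => [|z /negPf zy].
  rewrite /lap; under [in RHS]eq_bigr => z _ do rewrite mulrBr.
  by rewrite sumrB -mulr_suml; ring.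
by rewrite eq_sym zy mul0r.
Qed.

Lemma lapmx_sym w D : (forall y z, w y z = w z y) -> (lapmx w D)^T = lapmx w D.
Proof.
move=> w_sym; apply/matrixP => y z; rewrite !mxE w_sym eq_sym.
by have [->//|_] := eqVneq y z; rewrite !mul0r.
Qed.

Lemma lapmx_offdiag w D y z : y != z -> (lapmx w D y z != 0) = (w y z != 0).
Proof. by move=> /negPf yz; rewrite mxE yz mul0r sub0r oppr_eq0. Qed.

Lemma in_ker_lapmx S w D x : supported_on S w ->
  in_ker S (lapmx w D) x <->
  (forall y, y \notin S -> x y = 0) /\ (forall y, lap w x y + D y * x y = 0).
Proof.
move=> w_supp; split=> -[x_out x_ker]; split=> // y; last by rewrite mulmv_lapmx.
have [yS|yS] := boolP (y \in S); first by rewrite -mulmv_lapmx x_ker.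
rewrite x_out // mulr0 addr0; apply: lap_const => z /w_supp.
by rewrite (negPf yS).
Qed.

Lemma in_ker_lapmx0 S w x : supported_on S w ->
  in_ker S (lapmx w (fun=> 0)) x <->
  (forall y, y \notin S -> x y = 0) /\ (forall y, lap w x y = 0).
Proof.
move=> w_supp; rewrite in_ker_lapmx //.
by split=> -[x_out x_ker]; split=> // y; have := x_ker y; rewrite mul0r addr0.
Qed.

Lemma in_ker_restrict S w x : supported_on S w -> (forall y, lap w x y = 0) ->
  in_ker S (lapmx w (fun=> 0)) (fun z => (z \in S)%:R * x z).
Proof.
move=> w_supp harmonic; apply/in_ker_lapmx0 => //.
by split=> y; [move=> /negPf->; rewrite mul0r | rewrite lap_restrict].
Qed.

Lemma exists_voltage e u v :
  symmetric e -> u != v -> connect e u v ->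
  exists2 y, lap (unit_weight R e) y =1 dipole R u v & y u != y v.
Proof.
move=> e_sym uv conn; have w_sym := unit_weight_sym R e_sym.
pose L : 'M[R]_n := lapmx (unit_weight R e) (fun=> 0).
have LE x z : mulmv L x z = lap (unit_weight R e) x z.
  by rewrite mulmv_lapmx mul0r addr0.
have [x Lx|y Ly] := mulmv_solvable (M := L) (d := dipole R u v).
  rewrite sum_dipole (@lap_energy_le0_const _ _ e e_sym x _ u v) ?subrr //.
  rewrite big1 // => z _; rewrite -LE; have := Lx z.
  by rewrite lapmx_sym // => ->; rewrite mulr0.
exists y => [z|]; first by rewrite -LE.
apply: contraTneq (oner_neq0 R) => yuv; rewrite negbK.
have <- : dipole R u v u = 1 by rewrite /dipole eqxx (negPf uv) subr0.
rewrite -Ly LE; apply/eqP/lap_unit_const => z uz.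
apply: (@lap_energy_le0_const _ _ e e_sym) (connect1 uz).
under eq_bigr do rewrite -LE Ly mulrC.
by rewrite sum_dipole yuv subrr.
Qed.

(* The weight of uv cancels the unit current from [u] to [v] through the other
   edges. *)
Lemma exists_resonant_weight e u v :
  symmetric e -> u != v -> connect (delete_edge e u v) u v ->
  exists (t : R) y, [/\ t != 0, y u != y v &
                       forall z, lap (reweight_edge e u v t) y z = 0].
Proof.
move=> e_sym uv conn.
have [y Ly yuv] := exists_voltage (delete_edge_sym u v e_sym) uv conn.
exists (- (y u - y v)^-1), y; split=> // [|z].
  by rewrite oppr_eq0 invr_eq0 subr_eq0.
by rewrite lap_reweight_edge // Ly mulNr mulVf ?subr_eq0 // mulN1r subrr.
Qed.

End LaplacianMatrix.

(** * Matrices with a given graph *)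

Section Patterns.
Variables (F : fieldType) (n : nat) (G : sgraph n).
Implicit Types (S T : {set 'I_n}) (A B : 'M[F]_n) (b u x : 'I_n -> F) (c j : 'I_n).

Definition in_SG_on S A : Prop :=
  A^T = A /\ {in S &, forall y z, y != z -> (A y z != 0) = G y z}.

Definition allows_nullity_at S k j : Prop :=
  exists B u,
    [/\ in_SG_on S B, nullity_on S B = k, in_ker S B u & u j != 0].

Lemma in_SG_onS S T A : T \subset S -> in_SG_on S A -> in_SG_on T A.
Proof.
move=> /subsetP TS [symA patA]; split=> // y z /TS yS /TS zS; exact: patA.
Qed.

Lemma in_SG_on_eq0 S A y z : in_SG_on S A -> y \in S -> z \in S ->
  y != z -> ~~ G y z -> A y z = 0.
Proof. by case=> _ patA yS zS yz; rewrite -patA // negbK => /eqP. Qed.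

Lemma in_SG_on_neq0 S A y z : in_SG_on S A -> y \in S -> z \in S ->
  G y z -> A y z != 0.
Proof.
case=> _ patA yS zS yz; rewrite patA //.
by apply: contraTneq yz => ->; rewrite adj_irr.
Qed.

Definition border c b B : 'M[F]_n :=
  \matrix_(y, z) if y == c then b z else if z == c then b y else B y z.

Lemma mulmv_border_center c b B x :
  mulmv (border c b B) x c = \sum_z b z * x z.
Proof. by apply: eq_bigr => z _; rewrite mxE eqxx. Qed.

Lemma in_ker_border S c b B x :
  in_ker (S :\ c) (border c b B) x <-> in_ker (S :\ c) B x.
Proof.
have rowE y : x c = 0 -> y != c -> mulmv (border c b B) x y = mulmv B x y.
  move=> xc /negPf yc; apply: eq_bigr => z _; rewrite mxE yc.
  by have [->|//] := eqVneq z c; rewrite xc !mulr0.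
by split=> -[x_out x_ker]; split=> // y /[dup] /setD1P[yc _] /x_ker;
  rewrite rowE // x_out // setD11.
Qed.

Lemma border_sym c b B : B^T = B -> (border c b B)^T = border c b B.
Proof.
move=> symB; apply/matrixP => y z; rewrite !mxE.
have -> : B z y = B y z by rewrite -{1}symB mxE.
by have [yc|_] := eqVneq y c; have [zc|_] := eqVneq z c; rewrite ?yc ?zc.
Qed.

Lemma in_SG_on_border S c b B : in_SG_on (S :\ c) B ->
  {in S :\ c, forall z, (b z != 0) = G c z} -> in_SG_on S (border c b B).
Proof.
move=> [symB patB] supp_b; split; first exact: border_sym.
move=> y z yS zS yz; rewrite mxE; have [yc|yc] := eqVneq y c.
  by rewrite supp_b ?yc // in_setD1 zS andbT eq_sym -yc.
have [zc|zc] := eqVneq z c; first by rewrite zc adj_sym supp_b // in_setD1 yc.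
by rewrite patB // in_setD1 ?yc ?zc.
Qed.

Lemma nullity_on_D1_border S c b B :
  nullity_on (S :\ c) (border c b B) = nullity_on (S :\ c) B.
Proof.
suff kerE : (ker_on (S :\ c) (border c b B) == ker_on (S :\ c) B)%MS.
  by rewrite /nullity_on (eqmxP kerE).
apply/rV_eqP => x; have [to_B of_B] := in_ker_border S c b B (x 0).
by apply/in_kerP/in_kerP.
Qed.

Lemma nullity_on_border S c b B u : c \in S -> B^T = B ->
  in_ker (S :\ c) B u -> \sum_z b z * u z != 0 ->
  nullity_on (S :\ c) B = (nullity_on S (border c b B)).+1.
Proof.
move=> cS symB ku bu; rewrite -(nullity_on_D1_border _ c b).
apply: (nullity_onD1 (border_sym c b symB) cS (v := u)).
  exact/in_ker_border.
by rewrite mulmv_border_center.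
Qed.

End Patterns.

(* Each term of [\sum_z b z * u z] is zero or a square. *)
Lemma exists_neighbor_weights (R : realFieldType) n (G : sgraph n) (i j : 'I_n)
    (u : 'I_n -> R) : G i j -> u j != 0 ->
  exists b : 'I_n -> R,
    (forall z, (b z != 0) = G i z) /\ \sum_z b z * u z != 0.
Proof.
move=> Gij uj; pose b z : R := (G i z)%:R * (if u z == 0 then 1 else u z).
exists b; split=> [z|].
  rewrite mulf_eq0 negb_or pnatr_eq0 eqb0 negbK.
  by case: (eqVneq (u z) 0) => [_|uz]; rewrite ?oner_eq0 ?uz andbT.
apply: lt0r_neq0; rewrite (bigD1 j) //= /b Gij (negPf uj) mul1r -expr2.
apply: ltr_pwDl; first by rewrite exprn_even_gt0.
apply: sumr_ge0 => z _; have [->|_] := eqVneq (u z) 0; first by rewrite mulr0.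
by rewrite -mulrA -expr2 mulr_ge0 ?sqr_ge0.
Qed.

Lemma allows_nullity_pair_succP (R : realType) n (G : sgraph n) (i : 'I_n) k :
  allows_nullity_pair R G i k k.+1 <->
  exists2 j, G i j & allows_nullity_at R G [set~ i] k.+1 j.
Proof.
have delE : [set: 'I_n] :\ i = [set~ i] by rewrite setTD.
split=> [[A [[symA patA] [nullA]]]|[j Gij [B [u [SGB nullB ku uj]]]]].
  rewrite -nullity_on_del_rc => nullAi.
  have [] := (nullity_onD1P symA (in_setT i)).1.
    by rewrite delE nullAi nullity_on_setT nullA.
  move=> u; rewrite delE => ku ui.
  have [j /eqP] : exists j, A i j * u j <> 0.
    apply: contrapT => /forallNP row0; case/eqP: ui; apply: big1 => j _.
    exact: contrapT (row0 j).
  rewrite mulf_eq0 negb_or => /andP[Aij uj].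
  have ij : i != j by apply: contraNneq uj => <-; rewrite ku.1 // !inE eqxx.
  exists j; first by rewrite -patA.
  by exists A, u; split=> //; split=> // y z _ _; exact: patA.
have [b [bE bu]] := exists_neighbor_weights Gij uj.
rewrite -delE in SGB nullB ku.
have [symA patA] := in_SG_on_border SGB (fun z _ => bE z).
exists (border i b B); split; first by split=> // y z; apply: patA.
rewrite -nullity_on_del_rc -delE nullity_on_D1_border nullB.
have := nullity_on_border (in_setT i) SGB.1 ku bu.
by rewrite nullB nullity_on_setT => -[->].
Qed.

(** * Constructions of nullity two *)

Section Constructions.
Variables (R : realFieldType) (n : nat) (G : sgraph n).
Implicit Types (S A : {set 'I_n}) (c j : 'I_n).

Lemma in_SG_on_lapmx S w (D : 'I_n -> R) : (forall y z, w y z = w z y) ->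
  {in S &, forall y z, (w y z != 0) = G y z} -> in_SG_on G S (lapmx w D).
Proof.
move=> w_sym w_supp; split; first exact: lapmx_sym.
by move=> y z yS zS yz; rewrite lapmx_offdiag // w_supp.
Qed.

Definition killed_laplacian S A : 'M[R]_n :=
  lapmx (unit_weight R (induced G S)) (killing R (induced G S) A).

Lemma in_SG_on_killed_laplacian S A : in_SG_on G S (killed_laplacian S A).
Proof.
apply: in_SG_on_lapmx => [|y z yS zS].
  exact: unit_weight_sym (@induced_sym _ G S).
by rewrite unit_weight_neq0 /induced /= yS zS.
Qed.

Lemma in_ker_killed_laplacian S A x : in_ker S (killed_laplacian S A) x <->
  (forall y, y \notin S -> x y = 0) /\
  (forall y, lap (unit_weight R (induced G S)) x y
             + killing R (induced G S) A y * x y = 0).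
Proof.
apply: in_ker_lapmx => y z; rewrite unit_weight_neq0.
by case/and3P=> -> ->.
Qed.

Lemma in_ker_component_indicator S A a : a \in S -> a \in A ->
  in_ker S (killed_laplacian S A) (component_indicator R (induced G S) a).
Proof.
move=> aS aA; apply/in_ker_killed_laplacian; split=> y.
  move=> yS; rewrite /component_indicator; case ay: connect => //.
  by rewrite (connect_induced_mem aS ay) in yS.
rewrite killing_component_indicator // addr0.
by rewrite lap_component_indicator //; exact: induced_sym.
Qed.

Lemma nullity_on_killed_laplacian S A : A \subset S ->
  {in A &, forall a b, connect (induced G S) a b -> a = b} ->
  nullity_on S (killed_laplacian S A) = #|A|.
Proof.
move=> /subsetP AS unconn; apply/eqP; rewrite eqn_leq; apply/andP; split.
  apply: nullity_on_le_card => x /in_ker_killed_laplacian[_].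
  exact/lap_killing_eq0/induced_sym.
apply: (card_le_nullity_on (u := component_indicator R (induced G S))).
  by move=> a aA; apply: in_ker_component_indicator => //; exact: AS.
move=> a b aA bA; rewrite pnatr_eq0 eqb0 negbK.
by apply/idP/eqP => [/unconn->|->]; rewrite ?connect0.
Qed.

Lemma allows_nullity_at_unconnected S A j : A \subset S -> j \in A ->
  {in A &, forall a b, connect (induced G S) a b -> a = b} ->
  allows_nullity_at R G S #|A| j.
Proof.
move=> AS jA unconn.
exists (killed_laplacian S A), (component_indicator R (induced G S) j); split.
- exact: in_SG_on_killed_laplacian.
- exact: nullity_on_killed_laplacian.
- by apply: in_ker_component_indicator => //; exact: (subsetP AS).
- by rewrite /component_indicator connect0 oner_eq0.
Qed.

Lemma sum_branch_indicator S c a : separates G S c -> induced G S c a ->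
  \sum_z (G c z)%:R * component_indicator R (induced G (S :\ c)) a z = 1.
Proof.
move=> sep ca; have /and3P[cS _ Gca] := ca.
rewrite (bigD1 a) //= /component_indicator connect0 Gca mulr1 big1 ?addr0 //.
move=> z za; case az: connect; last by rewrite mulr0.
case cz: (G c z); last by rewrite mul0r.
have /setD1P[_ zS] := connect_induced_mem (induced_mem_D1 ca) az.
have /negP[] // : ~~ connect (induced G (S :\ c)) a z.
by apply: sep; rewrite 1?eq_sym // /induced /= cS zS cz.
Qed.

Lemma allows_nullity_at_branching S A c a a' j : separates G S c ->
  {in A, forall b, induced G S c b} -> a \in A -> a' \in A -> a' != a ->
  connect (induced G (S :\ c)) a j -> allows_nullity_at R G S #|A|.-1 j.
Proof.
move=> sep cA aA a'A a'a aj; have /and3P[cS _ _] := cA a aA.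
pose h := component_indicator R (induced G (S :\ c)).
pose B := killed_laplacian (S :\ c) A; pose b z : R := (G c z)%:R.
have AS p : p \in A -> p \in S :\ c by move=> /cA /induced_mem_D1.
have unconn : {in A &, forall p q, connect (induced G (S :\ c)) p q -> p = q}.
  move=> p q /cA cp /cA cq pq; apply/eqP; apply: contraLR pq; exact: sep.
have kh p : p \in A -> in_ker (S :\ c) B (h p).
  by move=> pA; apply: in_ker_component_indicator => //; exact: AS.
have row_h p : p \in A -> \sum_z b z * h p z = 1.
  by move=> /cA; exact: sum_branch_indicator.
exists (border c b B), (fun z => h a z - h a' z); split.
- apply: in_SG_on_border => [|z _]; first exact: in_SG_on_killed_laplacian.
  by rewrite pnatr_eq0 eqb0 negbK.
- have := nullity_on_border cS (in_SG_on_killed_laplacian _ _).1 (kh a aA) (b := b).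
  rewrite row_h // nullity_on_killed_laplacian //; last exact/subsetP.
  by move=> ->; rewrite ?oner_eq0.
- suff [] : in_ker S (border c b B) (fun z => h a z - h a' z) /\ h a c - h a' c = 0.
    by [].
  apply/in_kerD1P => //; split; first by apply/in_ker_border/in_kerB; exact: kh.
  rewrite mulmv_border_center; under eq_bigr do rewrite mulrBr.
  by rewrite sumrB !row_h ?subrr.
have a'j : ~~ connect (induced G (S :\ c)) a' j.
  apply: contra a'a => a'j; apply/eqP/unconn => //.
  by apply: connect_trans a'j _; rewrite induced_connect_sym.
by rewrite /h /component_indicator aj (negPf a'j) subr0 oner_eq0.
Qed.

Lemma reweight_edge_supported S u v (t : R) : induced G S u v -> t != 0 ->
  supported_on S (reweight_edge (induced G S) u v t).
Proof.
move=> uv t_neq0 y z; rewrite reweight_edge_neq0 //; last exact: induced_sym.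
by case/and3P=> -> ->.
Qed.

Lemma nullity_on_reweight_edge S u v t y : connected G S ->
  induced G S u v -> u != v -> connect (delete_edge (induced G S) u v) u v ->
  t != 0 -> y u != y v ->
  (forall z, lap (reweight_edge (induced G S) u v t) y z = 0) ->
  nullity_on S (lapmx (reweight_edge (induced G S) u v t) (fun=> 0 : R)) = 2%N.
Proof.
move=> [_ con] uv u_v uv' t_neq0 yuv Ly.
have w_supp := reweight_edge_supported uv t_neq0.
have /and3P[uS vS _] := uv.
have <- : #|[set u; v]| = 2%N by rewrite cards2 u_v.
apply/eqP; rewrite eqn_leq; apply/andP; split.
  apply: nullity_on_le_card => x /(in_ker_lapmx0 _ w_supp)[x_out harmonic] x0 z.
  have [zS|] := boolP (z \in S); last exact: x_out.
  have [xu xv] : x u = 0 /\ x v = 0 by rewrite !x0 ?set21 ?set22.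
  rewrite -xu; apply: (lap_reweight_edge_eq0_const _ u_v uv' harmonic).
  - exact: induced_sym.
  - by rewrite xu xv.
  - exact: con.
pose other p := if p == u then v else u.
apply: (card_le_nullity_on (u := fun p z => (z \in S)%:R * (y z - y (other p)))).
  by move=> p _; apply: in_ker_restrict => // z; rewrite lap_subC.
have v_u : v != u by rewrite eq_sym.
have yvu : y v != y u by rewrite eq_sym.
by move=> p q /set2P[]-> /set2P[]->; rewrite /other ?eqxx ?(negPf u_v)
  ?(negPf v_u) ?uS ?vS !mul1r subr_eq0 ?eqxx ?yuv ?yvu.
Qed.

Lemma allows_nullity_at_nonbridge S u v j : connected G S ->
  induced G S u v -> connect (delete_edge (induced G S) u v) u v -> j \in S ->
  allows_nullity_at R G S 2 j.
Proof.
move=> conS uv uv' jS; have e_sym := induced_sym G S.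
have u_v : u != v.
  by apply: contraTneq uv => ->; rewrite /induced /= adj_irr !andbF.
have [t [y [t_neq0 yuv Ly]]] := exists_resonant_weight R e_sym u_v uv'.
exists (lapmx (reweight_edge (induced G S) u v t) (fun=> 0)).
exists (fun z => (z \in S)%:R * 1); split.
- apply: in_SG_on_lapmx => [|a b aS bS]; first exact: reweight_edge_sym.
  by rewrite reweight_edge_neq0 // /induced /= aS bS.
- exact: nullity_on_reweight_edge Ly.
- apply: in_ker_restrict; first exact: reweight_edge_supported.
  by move=> z; apply: lap_const.
- by rewrite jS mul1r oner_eq0.
Qed.

End Constructions.

(** * Kernels over paths and generalized stars *)

Section Obstructions.
Variables (F : fieldType) (n : nat) (G : sgraph n) (S : {set 'I_n}) (A : 'M[F]_n).
Hypothesis SGA : in_SG_on G S A.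
Implicit Types (x w : 'I_n -> F) (a c y z : 'I_n).

Lemma in_ker_force x y z : in_ker S A x -> y \in S -> z \in S -> G y z ->
  x y = 0 -> {in S, forall t, G y t -> t != z -> x t = 0} -> x z = 0.
Proof.
move=> [x_out x_ker] yS zS yz xy other; have /eqP := x_ker y yS.
rewrite /mulmv (bigD1 z) //= big1 ?addr0 => [|t tz].
  by rewrite mulf_eq0 (negPf (in_SG_on_neq0 SGA yS zS yz)) => /eqP.
have [tS|/x_out->] := boolP (t \in S); last by rewrite mulr0.
have [Gyt|Gyt] := boolP (G y t); first by rewrite other ?mulr0.
have [<-|yt] := eqVneq y t; first by rewrite xy mulr0.
by rewrite (in_SG_on_eq0 SGA) ?mul0r.
Qed.

Lemma is_path_nullity_on_le1 : is_path G S -> (nullity_on S A <= 1)%N.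
Proof.
case=> m [f [m_gt0 f_inj SE fG]]; rewrite -(cards1 (f (Ordinal m_gt0))).
apply: nullity_on_le_card => x kx x0.
have fS k : f k \in S by rewrite SE imset_f.
have xf p (pm : (p < m)%N) : x (f (Ordinal pm)) = 0.
  elim/ltn_ind: p pm => -[|p] IHp pm.
    by rewrite (bool_irrelevance pm m_gt0) x0 ?set11.
  have p'm : (p < m)%N by exact: ltnW.
  apply: (in_ker_force (y := f (Ordinal p'm))) => //; rewrite ?fG /= ?eqxx ?IHp //.
  move=> t; rewrite SE => /imsetP[[k km] _ ->].
  rewrite fG (inj_eq f_inj) -val_eqE /=.
  by case/orP=> /eqP kE kp; [rewrite kE eqxx in kp | apply: IHp; lia].
move=> y; have [|yS] := boolP (y \in S); last exact: kx.1.
by rewrite SE => /imsetP[[k km] _ ->].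
Qed.

Lemma in_ker_branch_eq0 c x p a q :
  {in S, forall y, y != c -> (degree G S y <= 2)%N} ->
  in_ker S A x -> x p = 0 -> x a = 0 -> a != c -> induced G S p a ->
  path (induced G (S :\ c)) a q -> uniq [:: p, a & q] -> x (last a q) = 0.
Proof.
move=> deg2 kx; elim: q p a => //= b q IHq p a xp xa ac pa /andP[ab bq].
case/and3P=> p_notin a_notin q_uniq; have /and3P[pS aS Gpa] := pa.
have /and3P[_ /setD1P[bc bS] Gab] := ab.
apply: (IHq a b) => //=; last 2 first.
- by rewrite /induced /= aS bS.
- by rewrite a_notin.
apply: in_ker_force xa _ => // t tS Gat tb.
have [->//|tp] := eqVneq t p.
have := deg2 a aS ac; rewrite leqNgt => /negP[]; apply/card_gt2P.
exists p, b, t; rewrite !inE pS bS tS adj_sym Gpa Gab Gat tp [b == t]eq_sym tb.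
by move: p_notin; rewrite !inE !negb_or => /and3P[_ -> _].
Qed.

Lemma in_ker_star_eq0 c x : connected G S -> c \in S ->
  {in S, forall y, y != c -> (degree G S y <= 2)%N} ->
  in_ker S A x -> x c = 0 -> (forall a, induced G S c a -> x a = 0) ->
  forall y, x y = 0.
Proof.
move=> [_ con] cS deg2 kx xc x_nbr y.
have [yS|] := boolP (y \in S); last exact: kx.1.
have [->//|yc] := eqVneq y c.
have [a [q [ca aq uq ->]]] := connect_first_step (con c y cS yS) yc.
have /setD1P[ac _] := induced_mem_D1 ca.
exact: in_ker_branch_eq0 deg2 kx xc (x_nbr a ca) ac ca aq uq.
Qed.

Lemma in_ker_component w a : in_ker S A w ->
  in_ker S A (fun z => component_indicator F (induced G S) a z * w z).
Proof.
move=> [w_out w_ker]; split=> y yS; first by rewrite w_out ?mulr0.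
have -> : 0 = component_indicator F (induced G S) a y * mulmv A w y.
  by rewrite w_ker ?mulr0.
rewrite mulr_sumr; apply: eq_bigr => z _; rewrite mulrCA.
have [zS|/w_out->] := boolP (z \in S); last by rewrite !mulr0.
have [<-//|yz] := eqVneq y z.
have [Gyz|Gyz] := boolP (G y z); last by rewrite (in_SG_on_eq0 SGA) ?(mulr0, mul0r).
congr (_%:R * _); congr nat_of_bool.
apply: same_connect1r; first exact: induced_connect_sym.
by rewrite /induced /= adj_sym zS yS.
Qed.

End Obstructions.

(* A kernel vector vanishing at [c] but not on the branch through [a], cut down
   to that branch, is mapped by [A] to a nonzero multiple of [e_c]; as [A] is
   symmetric, this multiple is orthogonal to the kernel. *)
Lemma star_in_ker_center_eq0 (F : fieldType) n (G : sgraph n) (S : {set 'I_n})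
    (A : 'M[F]_n) c x : in_SG_on G S A -> is_tree G S -> c \in S ->
  {in S, forall y, y != c -> (degree G S y <= 2)%N} ->
  (1 < nullity_on S A)%N -> in_ker S A x -> x c = 0.
Proof.
move=> SGA [conS acyc] cS deg2; rewrite -(cards1 c).
move=> /nullity_on_vanish[w [kw wc [y wy]]] kx; have {}wc := wc c (set11 c).
have [a ca wa] : exists2 a, induced G S c a & w a != 0.
  apply: contrapT => no_nbr; case/eqP: wy.
  apply: (in_ker_star_eq0 SGA conS cS deg2 kw wc) => a ca.
  by apply: contrapT => /eqP wa; apply: no_nbr; exists a.
have [kw' _] := (in_kerD1P A w cS).1 (conj kw wc).
have SGA' := in_SG_onS (subD1set S c) SGA.
have := in_ker_pairing SGA.1 kx (in_ker_component SGA' a kw').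
have /and3P[_ aS Gca] := ca.
rewrite /mulmv /component_indicator (bigD1 a) //= connect0 mul1r.
rewrite big1 ?addr0 => [/eqP|z za].
  have /negPf Aca := in_SG_on_neq0 SGA cS aS Gca.
  by rewrite !mulf_eq0 (negPf wa) Aca !orbF => /eqP.
case az: connect; last by rewrite mul0r mulr0.
have /setD1P[zc zS] := connect_induced_mem (induced_mem_D1 ca) az.
rewrite (in_SG_on_eq0 SGA) ?mul0r // 1?eq_sym //; apply: contraTN az => Gcz.
by apply: (acyclic_separates acyc ca); rewrite 1?eq_sym // /induced /= cS zS.
Qed.

(** * The characterization *)

Section Characterization.
Variables (R : realFieldType) (n : nat) (G : sgraph n).
Implicit Types (S : {set 'I_n}) (c j : 'I_n).

Lemma is_path_not_allows_nullity_at S k j : is_path G S -> (1 < k)%N ->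
  ~ allows_nullity_at R G S k j.
Proof.
move=> pathS k_gt1 [A [_ [SGA nullA _ _]]].
by have := is_path_nullity_on_le1 SGA pathS; rewrite nullA leqNgt k_gt1.
Qed.

Lemma is_center_not_allows_nullity_at S k c : is_center G S c -> (1 < k)%N ->
  ~ allows_nullity_at R G S k c.
Proof.
move=> centerS k_gt1 [A [x [SGA nullA kx /eqP[]]]].
have [[treeS _] [cS _]] := centerS.
apply: (star_in_ker_center_eq0 SGA treeS cS) kx; last by rewrite nullA.
move=> y yS yc.
rewrite leqNgt; apply/negP => y3; case/eqP: yc.
exact: high_degree_center centerS (conj yS y3).
Qed.

Lemma allows_nullity2_at_not_connected S j : j \in S -> ~ connected G S ->
  allows_nullity_at R G S 2 j.
Proof.
move=> jS not_con.
have [a aS ja] : exists2 a, a \in S & ~~ connect (induced G S) j a.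
  apply: contrapT => all_con; apply: not_con.
  split; first by apply/set0Pn; exists j.
  have con_j y : y \in S -> connect (induced G S) j y.
    by move=> yS; apply: contrapT => /negP jy; apply: all_con; exists y.
  by move=> y z /con_j yj /con_j; apply: connect_trans; rewrite induced_connect_sym.
have ja_neq : j != a by apply: contraNneq ja => ->; exact: connect0.
rewrite -[2%N](_ : #|[set j; a]| = _); last by rewrite cards2 ja_neq.
apply: allows_nullity_at_unconnected.
- by apply/subsetP => z /set2P[]->.
- exact: set21.
move=> y z /set2P[]-> /set2P[]-> //; first by rewrite (negPf ja).
by rewrite induced_connect_sym (negPf ja).
Qed.

Lemma allows_nullity2_at_high_degree S c j : connected G S -> acyclic G S ->
  high_degree G S c -> j \in S -> j != c -> allows_nullity_at R G S 2 j.
Proof.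
move=> [_ con] acyc [cS c3] jS jc.
have [a [q [ca aq _ jE]]] := connect_first_step (con c j cS jS) jc.
pose N := [set y in S | G c y].
have NE y : y \in N -> induced G S c y by rewrite inE /induced /= cS.
have aN : a \in N by have /and3P[_ aS ca'] := ca; rewrite inE aS.
have : (1 < #|N :\ a|)%N by move: c3; rewrite /degree -/N (cardsD1 a N) aN.
case/card_gt1P=> b1 [b2 [/setD1P[b1a b1N] /setD1P[b2a b2N] b12]].
have card3 : #|[set a; b1; b2]| = 3%N.
  by rewrite -setUA cardsU1 cards2 !inE negb_or ![a == _]eq_sym b1a b2a b12.
rewrite -[2%N]/(3.-1) -card3.
have sep : separates G S c := acyclic_separates acyc.
apply: (allows_nullity_at_branching _ sep (a := a) (a' := b1)) => //.
- by move=> b; rewrite !inE -orbA => /or3P[] /eqP->; exact: NE.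
- by rewrite !inE eqxx.
- by rewrite !inE eqxx orbT.
- by apply/connectP; exists q.
Qed.

Lemma allows_nullity2_atP S j : j \in S ->
  allows_nullity_at R G S 2 j <-> ~ (is_path G S \/ is_center G S j).
Proof.
move=> jS; split=> [allows [pathS|centerS]|not_path_center].
- exact: is_path_not_allows_nullity_at pathS _ allows.
- exact: is_center_not_allows_nullity_at centerS _ allows.
have [conS|] := pselect (connected G S); last first.
  exact: allows_nullity2_at_not_connected.
have [acyc|] := pselect (acyclic G S); last first.
  move=> /not_acyclic_nonbridge[u [v [uv uv']]].
  exact: allows_nullity_at_nonbridge uv uv' jS.
have [[c [hc cj]]|only_j] := pselect (exists c, high_degree G S c /\ j != c).
  exact: allows_nullity2_at_high_degree hc jS cj.
have high_j c : high_degree G S c -> j = c.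
  by move=> hc; apply: contrapT => /eqP jc; apply: only_j; exists c.
case: not_path_center; have [hj|low_j] := pselect (high_degree G S j); [right|left].
  by split=> //; split=> //; exists j.
apply: acyclic_degree2_is_path => // y yS; rewrite leqNgt; apply/negP => y3.
by apply: low_j; rewrite (high_j y).
Qed.

End Characterization.

Lemma yam_le1_componentsP n (G : sgraph n) (i : 'I_n) : connected G setT ->
  is_yam G i /\ (#|components G [set~ i]| <= 1)%N <->
  (forall j, G i j -> is_path G [set~ i] \/ is_center G [set~ i] j).
Proof.
move=> conG; set S := [set~ i].
split=> [[[_ yam] le1] j Gij|path_or_center].
  have conS : connected G S.
    apply: components_le1_connected le1; apply/set0Pn; exists j.
    exact: neighbor_in_setC1 Gij.
  have SC : S \in components G S by rewrite connected_components ?set11.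
  have [[star|] star_nbr] := yam S SC; last by left.
  by right; apply/(star_nbr star j (neighbor_in_setC1 Gij)).
have [[x xi]|alone] := pselect (exists x, x != i); last first.
  have comp0 : components G S = set0.
    apply/setP => C; rewrite inE; apply/imsetP => -[x xS _]; apply: alone.
    by exists x; rewrite !inE in xS.
  by rewrite comp0 cards0; split=> //; split=> // C; rewrite comp0 inE.
have [j0 Gij0] := connectedT_neighbor conG xi.
have conS : connected G S.
  by case: (path_or_center j0 Gij0) => [/is_path_connected|[[[]]]].
have compE := connected_components conS.
rewrite compE cards1; split=> //; split=> // C; rewrite compE => /set1P->.
have star_nbr j : is_generalized_star G S -> G i j -> is_center G S j.
  by move=> /generalized_star_not_path not_path /path_or_center[/not_path|].
split=> [|star j jS].
  by case: (path_or_center j0 Gij0) => [|[]]; [right|left].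
split=> [|[_ high_j]]; first exact: star_nbr star.
by rewrite (high_degree_center (star_nbr j0 star Gij0) high_j).
Qed.

Theorem theorem5p11 (R : realType) (n : nat) (G : sgraph n) (i : 'I_n)
    (conG : connected G [set: 'I_n]) :
  allows_nullity_pair R G i 1 2 <->
  ~ (is_yam G i /\ (#|components G [set~ i]| <= 1)%N).
Proof.
have nbrP j : G i j -> allows_nullity_at R G [set~ i] 2 j <->
    ~ (is_path G [set~ i] \/ is_center G [set~ i] j).
  by move=> Gij; apply: allows_nullity2_atP; exact: neighbor_in_setC1 Gij.
rewrite yam_le1_componentsP // allows_nullity_pair_succP; split=> [[j Gij]|].
  by move/(nbrP j Gij)=> + all_nbr; apply; exact: all_nbr.
move=> not_all; apply: contrapT => no_j; apply: not_all => j Gij.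
by apply: contrapT => /(nbrP j Gij) allows; apply: no_j; exists j.
Qed.
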